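(* Let $L$ be any non-trivial linear subspace of $\mathbb{R}^n$ and let $Z_L(R) := \{x\in\mathbb{R}^n : |\mathrm{proj}_L(x)|^2\leq R^2\}$. If $\varphi\colon B(r)\to\mathbb{R}^n$ is an isometric embedding such that $\varphi(B(r))\subseteq Z_L(R)$, then $r\leq R$.
   Context: $\mathbb{R}^n$ carries the standard Euclidean metric; $\mathrm{proj}_L$ is the orthogonal projection onto $L$; $r,R>0$ are real numbers; $B(r)$ is the closed ball of radius $r$ centered at the origin in $\mathbb{R}^n$. *)

(* Defs.v *)
From HB Require Import structures.
From mathcomp Require Import all_boot all_order all_algebra.
From mathcomp Require Import classical_sets reals.

Set Implicit Arguments.
Unset Strict Implicit.
Unset Printing Implicit Defensive.
Import Order.TTheory GRing.Theory Num.Theory.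
Local Open Scope classical_set_scope.
Local Open Scope ring_scope.

(* R^n is 'rV[K]_n with K : realType. Its library norm in mathcomp-analysis is
   the sup norm, hence the separate Euclidean inner product, norm and
   distance. *)
Section Euclidean.
Context {K : realType} {n : nat}.
Implicit Types (x y : 'rV[K]_n) (L V : {vspace 'rV[K]_n}).

Definition edot x y : K := \sum_(i < n) x 0 i * y 0 i.

Lemma edotC x y : edot x y = edot y x.
Proof. by apply: eq_bigr => i _; rewrite mulrC. Qed.

Lemma edot_linear x : linear_for *%R (edot x).
Proof.
move=> a y z; rewrite /edot mulr_sumr -big_split; apply: eq_bigr => i _ /=.
by rewrite !mxE mulrDr mulrCA.
Qed.

Fact edot_bilinear :
  bilinear_for (GRing.Scale.Law.clone _ _ *%R _)
    (GRing.Scale.Law.clone _ _ (idfun \; *%R) _) edot.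
Proof.
split=> [y a x z | x a y z] /=; last exact: edot_linear.
by rewrite !(edotC _ y) edot_linear.
Qed.
HB.instance Definition _ :=
  bilinear_isBilinear.Build K 'rV[K]_n 'rV[K]_n K _ _ edot edot_bilinear.

Fact edot_hermitian x y : edot x y = (-1) ^+ false * idfun (edot y x).
Proof. by rewrite mul1r edotC. Qed.
HB.instance Definition _ :=
  isHermitianSesquilinear.Build K 'rV[K]_n false idfun edot edot_hermitian.

Fact edot_gt0 x : x != 0 -> 0 < edot x x.
Proof.
move=> x0; have ge0 (i : 'I_n) : true -> 0 <= x 0 i * x 0 i.
  by rewrite -expr2 sqr_ge0.
rewrite lt_def sumr_ge0 // andbT; apply: contraNneq x0 => /eqP.
rewrite psumr_eq0 // => /allP h; apply/eqP/rowP => i; rewrite mxE.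
by have := h i (mem_index_enum _); rewrite mulf_eq0 orbb => /eqP.
Qed.
HB.instance Definition _ := isDotProduct.Build K 'rV[K]_n edot edot_gt0.

Definition enorm x : K := Num.sqrt (edot x x).
Definition edist x y : K := enorm (x - y).

Definition ecball (r : K) : set 'rV[K]_n := [set x | enorm x <= r].

(* Linear projection onto L along its orthogonal complement orthov edot L; it
   is the orthogonal projection because the two are complementary, see
   eproj_orthogonal below. *)
Definition eproj L : 'End('rV[K]_n) := daddv_pi L (orthov edot L).

Definition cylinder L (R : K) : set 'rV[K]_n :=
  [set x | enorm (eproj L x) ^+ 2 <= R ^+ 2].

(* A map on A is given by a total function, whose values off A are
   irrelevant. *)
Definition isometric_embedding_on (A : set 'rV[K]_n)
    (f : 'rV[K]_n -> 'rV[K]_n) :=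
  forall x y, A x -> A y -> edist (f x) (f y) = edist x y.

Lemma capv_orthov L : (L :&: orthov edot L = 0)%VS.
Proof.
apply/eqP; rewrite -subv0; apply/subvP => x; rewrite memv_cap memv0.
move=> /andP[xL /mem_orthovP /(_ _ xL) xx]; apply/eqP/eqP.
by apply: contraT => /edot_gt0; rewrite xx ltxx.
Qed.

Lemma addv_orthov L : (L + orthov edot L = fullv)%VS.
Proof.
pose b i := (vbasis L)`_i.
pose g x : 'rV[K]_(\dim L) := \row_i edot (b i) x.
have g_lin : linear g.
  by move=> a x y; apply/rowP => i; rewrite !mxE edot_linear.
pose gM := GRing.isLinear.Build _ _ _ _ g g_lin.
pose gL : {linear 'rV[K]_n -> 'rV[K]_(\dim L)} := HB.pack g gM.
have ker : (lker (linfun gL) <= orthov edot L)%VS.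
  apply/subvP => x; rewrite memv_ker lfunE /= => /eqP /rowP gx0.
  apply/mem_orthovP => y /coord_vbasis ->.
  rewrite linear_sumr big1 // => i _; have := gx0 i; rewrite !mxE edotC => h.
  by rewrite linearZr /= [edot _ _]h mulr0.
apply/eqP; rewrite eqEdim subvf /= dimv_disjoint_sum ?capv_orthov //.
rewrite -(limg_ker_dim (linfun gL) fullv) capfv addnC leq_add ?dimvS //.
by apply: leq_trans (dimvS (subvf _)) _; rewrite dimvf /dim /= mul1n.
Qed.

Lemma eproj_mem L x : eproj L x \in L.
Proof. exact: memv_pi. Qed.

Lemma eproj_orthogonal L x y : y \in L -> edot (x - eproj L x) y = 0.
Proof.
have xD := daddv_pi_add (capv_orthov L) (w := x).
rewrite addv_orthov memvf in xD; rewrite -{1}(xD isT) addrC addKr.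
by apply/mem_orthovP; apply: memv_pi.
Qed.

End Euclidean.

(* Main.v *)
Require Import Defs.
From HB Require Import structures.
From mathcomp Require Import all_boot all_order all_algebra.
From mathcomp Require Import classical_sets reals.
From mathcomp Require Import ring lra.
Set Implicit Arguments.
Unset Strict Implicit.
Unset Printing Implicit Defensive.
Import Order.TTheory GRing.Theory Num.Theory.
Local Open Scope classical_set_scope.
Local Open Scope ring_scope.

(** An isometric embedding [phi] of the ball of radius [r] into a space of the
    same dimension is onto the ball of radius [r] about [phi 0], so its image
    has a diameter of length [2 r] in every direction
    ([isometric_ball_reaches]).  For a direction [u] in [L] the orthogonal
    projection to [L] does not shorten that diameter, while the projections of
    its endpoints have norm at most [R].  The parallelogram law then gives
    [(2 r)^2 <= 2 R^2 + 2 R^2].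

    Surjectivity onto the sphere is linear algebra.  Fixing the origin and
    preserving distances, [psi x = phi x - phi 0] preserves inner products by
    polarization ([isometry_edot]), so the [n] vectors [psi (r e_i)] are
    orthogonal of norm [r].  Being [n] in number they form a basis, and a
    vector is determined by its inner products with them; this identifies the
    preimage of [r u] explicitly, with no appeal to continuity or to
    invariance of domain. *)

Section EuclideanIsometry.
Context {K : realType} {n : nat}.
Implicit Types (x y u v : 'rV[K]_n) (L : {vspace 'rV[K]_n}).

Lemma edot_mulmx x y : edot x y = (x *m y^T) 0 0.
Proof. by rewrite mxE; apply: eq_bigr => i _; rewrite mxE. Qed.

Lemma edot_ge0 x : 0 <= edot x x.
Proof. by apply: sumr_ge0 => i _; rewrite -expr2 sqr_ge0. Qed.

Lemma sqr_enorm x : enorm x ^+ 2 = edot x x.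
Proof. by rewrite sqr_sqrtr ?edot_ge0. Qed.

Lemma edotBB x y :
  edot (x - y) (x - y) = edot x x + edot y y - 2 * edot x y.
Proof. by rewrite linearBl !linearBr /= (edotC y x); ring. Qed.

Lemma edotDD x y :
  edot (x + y) (x + y) = edot x x + edot y y + 2 * edot x y.
Proof. by rewrite linearDl !linearDr /= (edotC y x); ring. Qed.

Lemma eproj_id L x : x \in L -> eproj L x = x.
Proof.
move=> xL; apply/esym/eqP; rewrite -subr_eq0; apply: contraT => /edot_gt0.
by rewrite eproj_orthogonal ?ltxx // rpredB // eproj_mem.
Qed.

Lemma ecball_sqr (r : K) x : 0 <= r -> ecball r x <-> edot x x <= r ^+ 2.
Proof.
move=> r0; rewrite -sqr_enorm /ecball /=.
by rewrite ler_sqr ?nnegrE ?sqrtr_ge0.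
Qed.

(** Polarization: the inner product of two differences with a common origin
    is determined by the three mutual distances. *)
Lemma isometry_edot (A : set 'rV[K]_n) (f : 'rV[K]_n -> 'rV[K]_n) :
  isometric_embedding_on A f -> forall o x y, A o -> A x -> A y ->
  edot (f x - f o) (f y - f o) = edot (x - o) (y - o).
Proof.
move=> fA o x y Ao Ax Ay.
have sq a b : A a -> A b -> edot (f a - f b) (f a - f b) = edot (a - b) (a - b).
  by move=> Aa Ab; rewrite -!sqr_enorm; congr (_ ^+ 2); apply: fA.
have subD (a b c : 'rV[K]_n) : a - b = (a - c) - (b - c).
  by rewrite opprB subrKA.
have := sq _ _ Ax Ay; rewrite (subD _ (f y) (f o)) (subD x y o).
rewrite [LHS]edotBB [RHS]edotBB (sq x o) // (sq y o) //; lra.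
Qed.

(** Let [F] have the orthogonal rows [f (r e_i) - f 0], so that
    [F F^T = F^T F = r^2].  The preimage of [f 0 + r u] is the vector whose
    coordinates are the inner products of [u] with these rows. *)
Lemma isometric_ball_reaches (r : K) (f : 'rV[K]_n -> 'rV[K]_n) u :
  0 < r -> isometric_embedding_on (ecball r) f -> edot u u = 1 ->
  exists2 x, ecball r x & f x - f 0 = r *: u.
Proof.
move=> r0 fisom u1; have r2 : r ^+ 2 != 0 by rewrite expf_neq0 ?gt_eqF.
have B0 : ecball r (0 : 'rV_n).
  by apply/ecball_sqr; [exact: ltW | rewrite linear0r sqr_ge0].
pose e i : 'rV[K]_n := r *: delta_mx 0 i.
have edot_e x i : edot x (e i) = r * x 0 i.
  rewrite /edot (bigD1 i) //= big1 => [|j /negPf ji].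
    by rewrite !mxE !eqxx mulr1 addr0 mulrC.
  by rewrite !mxE ji andbF !mulr0.
have Be i : ecball r (e i).
  by apply/ecball_sqr; [exact: ltW | rewrite edot_e !mxE !eqxx mulr1].
have dot x y : ecball r x -> ecball r y ->
    edot (f x - f 0) (f y - f 0) = edot x y.
  by move=> Bx By; rewrite (isometry_edot fisom) // !subr0.
pose F : 'M[K]_n := \matrix_i (f (e i) - f 0).
have mulF x i : (x *m F^T) 0 i = edot x (f (e i) - f 0).
  by rewrite mxE; apply: eq_bigr => j _; rewrite !mxE.
have FFT : F *m F^T = (r ^+ 2)%:M.
  apply/matrixP => i j; have := dot _ _ (Be i) (Be j).
  rewrite -mulF edot_e -(rowK (fun i => f (e i) - f 0)) -/F -row_mul mxE => ->.
  by rewrite !mxE /= [j == i]eq_sym; case: eqP => _; rewrite ?mulr0 ?mulr1.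
have FTF : F^T *m F = (r ^+ 2)%:M.
  have /mulmx1C : (r ^- 2 *: F) *m F^T = 1%:M.
    by rewrite -scalemxAl FFT scale_scalar_mx mulVf.
  by rewrite -scalemxAr => /(canRL (scalerKV r2)); rewrite scale_scalar_mx mulr1.
have Bx : ecball r (u *m F^T).
  apply/ecball_sqr; first exact: ltW.
  rewrite edot_mulmx trmx_mul trmxK mulmxA -(mulmxA u) FTF mul_mx_scalar.
  by rewrite -scalemxAl mxE -edot_mulmx u1 mulr1.
exists (u *m F^T) => //.
have : (f (u *m F^T) - f 0) *m F^T = (r *: u) *m F^T.
  by apply/rowP => i; rewrite mulF dot // edot_e -scalemxAl [RHS]mxE.
move=> /(congr1 (mulmx^~ F)); rewrite -!mulmxA FTF !mul_mx_scalar.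
exact: scalerI.
Qed.

Lemma exists_unit_vector L : L <> 0%VS -> exists2 u, u \in L & edot u u = 1.
Proof.
move=> /eqP; rewrite -vpick0 => /edot_gt0 v0.
exists ((enorm (vpick L))^-1 *: vpick L); first by rewrite rpredZ ?memv_pick.
rewrite linearZl_LR linearZr /= mulrA -expr2 exprVn sqr_enorm mulVf //.
exact: lt0r_neq0.
Qed.

End EuclideanIsometry.

Theorem proposition4p7 (K : realType) (n : nat) (L : {vspace 'rV[K]_n})
    (L_nontrivial : L <> 0%VS) (r R : K) (r_gt0 : 0 < r) (R_gt0 : 0 < R)
    (phi : 'rV[K]_n -> 'rV[K]_n)
    (phi_isom : isometric_embedding_on (ecball r) phi)
    (phi_cyl : phi @` ecball r `<=` cylinder L R) :
  r <= R.
Proof.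
have [u uL u1] := exists_unit_vector L_nontrivial.
have Nu1 : edot (- u) (- u) = 1 by rewrite linearNl linearNr opprK.
have [x Bx fx] := isometric_ball_reaches r_gt0 phi_isom u1.
have [y By fy] := isometric_ball_reaches r_gt0 phi_isom Nu1.
have cyl z : ecball r z ->
    edot (eproj L (phi z)) (eproj L (phi z)) <= R ^+ 2.
  by move=> Bz; rewrite -sqr_enorm; apply: phi_cyl; exists z.
have diam : eproj L (phi x) - eproj L (phi y) = (2 * r) *: u.
  rewrite -linearB -(subrKA (phi 0)) -(opprB (phi y)) fx fy scalerN opprK.
  by rewrite -mulr2n -scaler_nat scalerA /= eproj_id // rpredZ.
have diam2 : edot ((2 * r) *: u) ((2 * r) *: u) = 4 * r ^+ 2.
  by rewrite linearZl_LR linearZr /= u1; ring.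
suff : r ^+ 2 <= R ^+ 2 by rewrite ler_sqr ?nnegrE //; exact: ltW.
have := edot_ge0 (eproj L (phi x) + eproj L (phi y)).
move: diam2 (cyl x Bx) (cyl y By); rewrite -diam edotBB edotDD; lra.
Qed.
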